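(* If $Ef$ is proper on $\mathcal{N}^\infty$, then its recession function is $$(Ef)^\infty(x)=E\big[I_{h^\infty}(x)+k_0^\infty(x_0)+k_T^\infty(x_{T+})\big]\qquad(x\in\mathcal{N}^\infty).$$
   Context: $T>0$, $d\ge1$. $X$: left-continuous $x:\mathbb{R}\to\mathbb{R}^d$ of bounded variation constant on $(-\infty,0]$ and $(T,\infty)$; $x_{T+}$ value on $(T,\infty)$. $(\Omega,\mathcal{F},(\mathcal{F}_t)_{t\ge0},P)$: filtered probability space with the usual hypotheses; optional projection ${}^ov$ as usual. $\mathcal{N}^\infty$: adapted processes with paths in $X$ a.s. and essentially bounded total variation. $\mu$: random positive Radon measure on $[0,T]$, a.s. atomless with full support, optional ($E\int v\,d\mu=E\int{}^ov\,d\mu$ for bounded measurable $v$); $\eta(A)=E\int1_Ad\mu$; $\mathbb{L}^p=L^p(\Omega\times[0,T],\mathcal{F}\otimes\mathcal{B}([0,T]),\eta)$. $h$: predictable convex normal integrand on $\mathbb{R}^d$ with $h_t(x)\ge x\cdot v_t-\alpha_t$ for some $v\in\mathbb{L}^1$ and nonnegative $\alpha\in\mathbb{L}^1$; for a normal integrand $g$, $I_g(x,\omega)=\int g_t(x_t,\omega)d\mu_t(\omega)$ (integral $+\infty$ unless positive part integrable). $k_0,k_T$: convex normal integrands on $\mathbb{R}^d$, $\mathcal{F}_0$- resp. $\mathcal{F}_T$-measurable, with $Ek_0,Ek_T$ proper on $L^\infty(\mathbb{R}^d)$ and $Ek_0^*,Ek_T^*$ proper on $L^1(\mathbb{R}^d)$.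 $f(x,\omega)=I_h(x,\omega)+k_0(x_0,\omega)+k_T(x_{T+},\omega)$, $Ef(x)=E f(x)$. Recession function of a closed proper convex $g$: $g^\infty(u)=\sup_{\alpha>0}(g(\bar u+\alpha u)-g(\bar u))/\alpha$ for any $\bar u\in\operatorname{dom}g$; $h^\infty$, $k_0^\infty$, $k_T^\infty$ are defined pointwise in $(\omega,t)$ resp. $\omega$. *)

(* Defs.v *)
From mathcomp Require Import all_boot all_order all_algebra.
From mathcomp Require Import all_classical all_reals all_analysis measurable_realfun.
Import numFieldNormedType.Exports.
Import Order.TTheory GRing.Theory Num.Theory.
Set Implicit Arguments. Unset Strict Implicit. Unset Printing Implicit Defensive.
Local Open Scope classical_set_scope.
Local Open Scope ring_scope.

Definition dotv (R : realType) (d : nat) (x y : 'rV[R]_d) : R :=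
  \sum_(i < d) x ord0 i * y ord0 i.
(* a norm on R^d (the l1 norm; all norms on R^d are equivalent) *)
Definition vnorm (R : realType) (d : nat) (x : 'rV[R]_d) : R :=
  \sum_(i < d) `|x ord0 i|.

(** * Integrals of extended-real functions with the paper's convention:
    the integral is +oo unless the positive part is integrable. *)
Definition xint (dT : measure_display) (T : measurableType dT) (R : realType)
  (m : {measure set T -> \bar R}) (D : set T) (f : T -> \bar R) : \bar R :=
  if (\int[m]_(x in D) (f^\+)%E x < +oo)%E
  then (\int[m]_(x in D) (f^\+)%E x - \int[m]_(x in D) (f^\-)%E x)%E
  else +oo%E.

Definition Ex (dO : measure_display) (Omega : measurableType dO) (R : realType)
  (P : probability Omega R) (f : Omega -> \bar R) : \bar R :=
  xint P setT f.

Definition Gmeas (dO : measure_display) (Omega : measurableType dO) (R : realType)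
  (G : set (set Omega)) (f : Omega -> R) : Prop :=
  forall B : set R, measurable B -> G (f @^-1` B).

Definition Gmeasv (dO : measure_display) (Omega : measurableType dO) (R : realType)
  (d : nat) (G : set (set Omega)) (f : Omega -> 'rV[R]_d) : Prop :=
  forall i : 'I_d, Gmeas G (fun w => f w ord0 i).

Definition usual_filtration (dO : measure_display) (Omega : measurableType dO)
  (R : realType) (P : probability Omega R) (F : R -> set (set Omega)) : Prop :=
  [/\ forall t, 0 <= t -> sigma_algebra setT (F t),
      forall t, 0 <= t -> F t `<=` measurable,
      forall s t, 0 <= s -> s <= t -> F s `<=` F t,
      forall t A, 0 <= t -> (forall s, t < s -> F s A) -> F t A &
      forall A N, measurable N -> P N = 0%E -> A `<=` N -> F 0 A].

Definition adapted (dO : measure_display) (Omega : measurableType dO) (R : realType)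
  (F : R -> set (set Omega)) (X : Omega -> R -> R) : Prop :=
  forall t, 0 <= t -> Gmeas (F t) (fun w => X w t).

Definition cadlag (dO : measure_display) (Omega : measurableType dO) (R : realType)
  (X : Omega -> R -> R) : Prop :=
  forall w t, 0 <= t ->
    (X w s @[s --> t^'+] --> X w t) /\ (0 < t -> cvg (X w s @[s --> t^'-])).

Definition leftcont (dO : measure_display) (Omega : measurableType dO) (R : realType)
  (X : Omega -> R -> R) : Prop :=
  forall w t, 0 < t -> X w s @[s --> t^'-] --> X w t.

Definition optional_sets (dO : measure_display) (Omega : measurableType dO)
  (R : realType) (F : R -> set (set Omega)) : set (set (Omega * R)) :=
  smallest (sigma_algebra setT)
    [set A | exists (X : Omega -> R -> R) (B : set R),
       [/\ adapted F X, cadlag X, measurable B &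
           A = [set p | 0 <= p.2 /\ B (X p.1 p.2)]]].

Definition predictable_sets (dO : measure_display) (Omega : measurableType dO)
  (R : realType) (F : R -> set (set Omega)) : set (set (Omega * R)) :=
  smallest (sigma_algebra setT)
    [set A | exists (X : Omega -> R -> R) (B : set R),
       [/\ adapted F X, leftcont X, measurable B &
           A = [set p | 0 <= p.2 /\ B (X p.1 p.2)]]].

Definition optional_process (dO : measure_display) (Omega : measurableType dO)
  (R : realType) (F : R -> set (set Omega)) (v : Omega -> R -> R) : Prop :=
  forall B : set R, measurable B ->
    optional_sets F [set p | 0 <= p.2 /\ B (v p.1 p.2)].

Definition stopping_time (dO : measure_display) (Omega : measurableType dO)
  (R : realType) (F : R -> set (set Omega)) (tau : Omega -> \bar R) : Prop :=
  (forall w, (0 <= tau w)%E) /\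
  (forall t, 0 <= t -> F t [set w | (tau w <= t%:E)%E]).

Definition sigma_at (dO : measure_display) (Omega : measurableType dO)
  (R : realType) (F : R -> set (set Omega)) (tau : Omega -> \bar R) : set (set Omega) :=
  [set A | measurable A /\
     forall t, 0 <= t -> F t (A `&` [set w | (tau w <= t%:E)%E])].

(* ov is an optional projection of v: ov is optional and, for every stopping
   time tau, ov_tau 1_{tau<oo} = E[v_tau 1_{tau<oo} | F_tau] *)
Definition optional_projection (dO : measure_display) (Omega : measurableType dO)
  (R : realType) (P : probability Omega R) (F : R -> set (set Omega))
  (v ov : Omega -> R -> R) : Prop :=
  optional_process F ov /\
  forall tau, stopping_time F tau -> forall A, sigma_at F tau A ->
    (\int[P]_(w in A `&` [set w | (tau w < +oo)%E]) (v w (fine (tau w)))%:E =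
     \int[P]_(w in A `&` [set w | (tau w < +oo)%E]) (ov w (fine (tau w)))%:E)%E.

Definition I0T (R : realType) (T : R) : set R := [set t | 0 <= t <= T].

Definition random_measure (dO : measure_display) (Omega : measurableType dO)
  (R : realType) (P : probability Omega R) (T : R)
  (mu : Omega -> {measure set R -> \bar R}) : Prop :=
  [/\ forall w, mu w (~` I0T T) = 0%E,
      forall w, (mu w (I0T T) < +oo)%E,
      forall A, measurable A -> measurable_fun [set: Omega] (mu ^~ A),
      {ae P, forall w, forall t : R, mu w [set t] = 0%E} &
      {ae P, forall w, forall t e : R, 0 <= t <= T -> 0 < e ->
          (0 < mu w ([set s : R | (t - e < s < t + e)%R] `&` I0T T))%E}].

Definition optional_measure (dO : measure_display) (Omega : measurableType dO)
  (R : realType) (P : probability Omega R) (F : R -> set (set Omega)) (T : R)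
  (mu : Omega -> {measure set R -> \bar R}) : Prop :=
  forall v ov : Omega -> R -> R,
    measurable_fun setT (fun p : Omega * R => v p.1 p.2) ->
    (exists M : R, forall w t, `|v w t| <= M) ->
    optional_projection P F v ov ->
    (\int[P]_w (\int[mu w]_(t in I0T T) (v w t)%:E) =
     \int[P]_w (\int[mu w]_(t in I0T T) (ov w t)%:E))%E.

Definition L1eta (dO : measure_display) (Omega : measurableType dO)
  (R : realType) (d : nat) (P : probability Omega R) (T : R)
  (mu : Omega -> {measure set R -> \bar R}) (v : Omega -> R -> 'rV[R]_d) : Prop :=
  (forall i : 'I_d, measurable_fun setT (fun p : Omega * R => v p.1 p.2 ord0 i)) /\
  (\int[P]_w (\int[mu w]_(t in I0T T) (vnorm (v w t))%:E) < +oo)%E.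

Definition L1eta_scalar (dO : measure_display) (Omega : measurableType dO)
  (R : realType) (P : probability Omega R) (T : R)
  (mu : Omega -> {measure set R -> \bar R}) (a : Omega -> R -> R) : Prop :=
  measurable_fun setT (fun p : Omega * R => a p.1 p.2) /\
  (\int[P]_w (\int[mu w]_(t in I0T T) `|a w t|%:E) < +oo)%E.

Definition epi_closed (R : realType) (d : nat) (g : 'rV[R]_d -> \bar R) : Prop :=
  closed [set p : ('rV[R]_d * R)%type | (g p.1 <= p.2%:E)%E].

Definition convex_ext (R : realType) (d : nat) (g : 'rV[R]_d -> \bar R) : Prop :=
  forall (x y : 'rV[R]_d) (l : R), 0 < l < 1 ->
    (g (l *: x + (1 - l) *: y)%R <= l%:E * g x + (1 - l)%:E * g y)%E.

(* h is a predictable convex normal integrand on Omega x [0,T]: epigraphs closed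
   and convex, and the epigraphical mapping is predictably measurable *)
Definition predictable_convex_normal (dO : measure_display) (Omega : measurableType dO)
  (R : realType) (d : nat) (F : R -> set (set Omega)) (T : R)
  (h : Omega -> R -> 'rV[R]_d -> \bar R) : Prop :=
  (forall w t, 0 <= t <= T -> epi_closed (h w t) /\ convex_ext (h w t)) /\
  (forall O : set ('rV[R]_d * R)%type, open O ->
     predictable_sets F
       [set p | 0 <= p.2 <= T /\ exists q, O q /\ (h p.1 p.2 q.1 <= q.2%:E)%E]).

Definition convex_normal (dO : measure_display) (Omega : measurableType dO)
  (R : realType) (d : nat) (G : set (set Omega)) (k : Omega -> 'rV[R]_d -> \bar R) : Prop :=
  (forall w, epi_closed (k w) /\ convex_ext (k w)) /\
  (forall O : set ('rV[R]_d * R)%type, open O ->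
     G [set w | exists q, O q /\ (k w q.1 <= q.2%:E)%E]).

Definition conjugate (dO : measure_display) (Omega : measurableType dO)
  (R : realType) (d : nat) (k : Omega -> 'rV[R]_d -> \bar R) : Omega -> 'rV[R]_d -> \bar R :=
  fun w y => ereal_sup (range (fun x => ((dotv x y)%:E - k w x)%E)).

Definition Linf (dO : measure_display) (Omega : measurableType dO)
  (R : realType) (d : nat) (P : probability Omega R) (u : Omega -> 'rV[R]_d) : Prop :=
  (forall i : 'I_d, measurable_fun setT (fun w => u w ord0 i)) /\
  exists M : R, {ae P, forall w, vnorm (u w) <= M}.

Definition L1 (dO : measure_display) (Omega : measurableType dO)
  (R : realType) (d : nat) (P : probability Omega R) (u : Omega -> 'rV[R]_d) : Prop :=
  (forall i : 'I_d, measurable_fun setT (fun w => u w ord0 i)) /\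
  (\int[P]_w (vnorm (u w))%:E < +oo)%E.

Definition Ek (dO : measure_display) (Omega : measurableType dO)
  (R : realType) (d : nat) (P : probability Omega R) (k : Omega -> 'rV[R]_d -> \bar R)
  (u : Omega -> 'rV[R]_d) : \bar R :=
  Ex P (fun w => k w (u w)).

Definition proper_on (U : Type) (R : realType) (S : set U) (g : U -> \bar R) : Prop :=
  (forall u, S u -> (-oo < g u)%E) /\ exists u, S u /\ (g u < +oo)%E.

Definition TV (R : realType) (d : nat) (p : R -> 'rV[R]_d) : \bar R :=
  ereal_sup [set z | exists (n : nat) (s : nat -> R),
     (forall i, (i < n)%N -> s i <= s i.+1) /\
     z = (\sum_(i < n) vnorm (p (s i.+1) - p (s i)))%:E].

Definition in_X (R : realType) (d : nat) (T : R) (p : R -> 'rV[R]_d) : Prop :=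
  [/\ forall t : R, p s @[s --> t^'-] --> p t,
      (TV p < +oo)%E,
      forall t, t <= 0 -> p t = p 0 &
      forall s t, T < s -> T < t -> p s = p t].

Definition Ninf (dO : measure_display) (Omega : measurableType dO)
  (R : realType) (d : nat) (P : probability Omega R) (F : R -> set (set Omega)) (T : R)
  (x : Omega -> R -> 'rV[R]_d) : Prop :=
  [/\ forall t, 0 <= t -> Gmeasv (F t) (fun w => x w t),
      {ae P, forall w, in_X T (x w)} &
      exists M : R, {ae P, forall w, (TV (x w) <= M%:E)%E}].

(* x_{T+}: the value of the path on (T, oo) *)
Definition xTplus (R : realType) (d : nat) (T : R) (p : R -> 'rV[R]_d) : 'rV[R]_d :=
  p (T + 1).

Definition Ig (dO : measure_display) (Omega : measurableType dO)
  (R : realType) (d : nat) (T : R) (mu : Omega -> {measure set R -> \bar R})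
  (g : Omega -> R -> 'rV[R]_d -> \bar R) (x : Omega -> R -> 'rV[R]_d) (w : Omega) : \bar R :=
  xint (mu w) (I0T T) (fun t => g w t (x w t)).

Definition Ef (dO : measure_display) (Omega : measurableType dO)
  (R : realType) (d : nat) (P : probability Omega R) (T : R)
  (mu : Omega -> {measure set R -> \bar R}) (h : Omega -> R -> 'rV[R]_d -> \bar R)
  (k0 kT : Omega -> 'rV[R]_d -> \bar R) (x : Omega -> R -> 'rV[R]_d) : \bar R :=
  Ex P (fun w => (Ig T mu h x w + k0 w (x w 0%R) + kT w (xTplus T (x w)))%E).

(* recession function of a (closed proper) convex g on R^d:
   sup_{alpha>0} (g(ub + alpha u) - g(ub))/alpha, ub ranging over dom g
   (independent of ub when g is closed proper convex) *)
Definition recession (R : realType) (d : nat) (g : 'rV[R]_d -> \bar R) (u : 'rV[R]_d) : \bar R :=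
  ereal_sup [set z | exists (ub : 'rV[R]_d) (a : R),
     [/\ g ub \is a fin_num, 0 < a & z = ((g (ub + a *: u)%R - g ub) * (a^-1)%:E)%E]].

Definition recession_at (dO : measure_display) (Omega : measurableType dO)
  (R : realType) (d : nat) (G : (Omega -> R -> 'rV[R]_d) -> \bar R)
  (ubar x : Omega -> R -> 'rV[R]_d) : \bar R :=
  ereal_sup [set z | exists a : R,
     0 < a /\ z = ((G (fun w t => (ubar w t + a *: x w t)%R) - G ubar) * (a^-1)%:E)%E].

(* Main.v *)
(* For a closed convex g > -oo and a point v of dom g, the slopes
   (g (v + a u) - g v) / a are nondecreasing in a and their supremum is the
   recession function at u, whatever v. Nondecreasing slopes are stable under sums
   and integration, and by monotone convergence so is taking their supremum. This
   is used for h with respect to mu, then for I_h + k_0 + k_T with respect to P. *)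
Require Import Defs.
From HB Require Import structures.
From mathcomp Require Import all_boot all_order all_algebra.
From mathcomp Require Import all_classical all_reals all_analysis measurable_realfun.
From mathcomp Require Import ring lra.
Import numFieldNormedType.Exports.
Import Order.TTheory GRing.Theory Num.Theory.
Import HBNNSimple.
Local Open Scope classical_set_scope.
Local Open Scope ring_scope.

(** * Difference quotients of convex functions *)

(** Interchanging slopes and integrals needs control from below. Inside, paths of bounded variation
    are bounded, so the minorant [x . v - alpha] makes the negative part of [h] integrable along the
    whole ray, for almost every [w]. Outside, only [Ef > -oo] along the ray is known. Under the
    convention for integrals this leaves two cases: the integrand is integrable, or its positive
    part has infinite integral and the slope is [+oo]. Closed convexity alone does not keep [k0] and
    [kT] above [-oo]; a dual variable at which the expected conjugate is below [+oo] does so almost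
    surely. Pointwise facts hold only off null sets, which are cut out of the domains of integration
    so that nothing has to be known about recession functions there. *)

Definition slope {R : realType} (phi : R -> \bar R) (b : \bar R) (a : R) : \bar R :=
  ((phi a - b) * (a^-1)%:E)%E.

Definition slope_sup {R : realType} (phi : R -> \bar R) (b : \bar R) : \bar R :=
  ereal_sup [set z | exists a : R, 0 < a /\ z = slope phi b a].

Definition slope_mono {R : realType} (phi : R -> \bar R) (b : \bar R) : Prop :=
  [/\ b \is a fin_num, forall a, 0 < a -> (-oo < phi a)%E &
      forall a c, 0 < a -> a <= c -> (slope phi b a <= slope phi b c)%E].

Section Slopes.
Context {R : realType}.
Implicit Types (phi psi : R -> \bar R) (b c : \bar R) (a : R).

Lemma slope_gtNy phi b a : b \is a fin_num -> 0 < a -> (-oo < phi a)%E ->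
  (-oo < slope phi b a)%E.
Proof.
rewrite /slope; case: b => // b _ a0.
case: (phi a) => [r| |]//= _; first exact: ltNyr.
by rewrite addye// mulyr gtr0_sg ?invr_gt0// mul1e.
Qed.

Lemma slope_le_sup phi b a : 0 < a -> (slope phi b a <= slope_sup phi b)%E.
Proof. by move=> a0; apply: ereal_sup_ubound; exists a. Qed.

(** Monotonicity makes the positive integers cofinal among the slopes, so the supremum becomes the
    limit of a sequence, the form that convergence theorems accept. *)
Lemma slope_supE phi b : slope_mono phi b ->
  slope_sup phi b = ereal_sup (range (fun n : nat => slope phi b n.+1%:R)).
Proof.
move=> [_ _ mono]; apply/eqP; rewrite eq_le; apply/andP; split.
- apply: ge_ereal_sup => _ [a [a0 ->]].
  apply: (le_trans (mono a (Num.truncn a).+1%:R a0 _)).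
    by apply: ltW; exact: truncnS_gt.
  by apply: ereal_sup_ubound; exists (Num.truncn a).
- by apply: ge_ereal_sup => _ [n _ <-]; apply: slope_le_sup.
Qed.

Lemma slope_nd phi b : slope_mono phi b ->
  nondecreasing_seq (fun n : nat => slope phi b n.+1%:R).
Proof. by move=> [_ _ mono] n m nm; apply: mono => //; rewrite ler_nat. Qed.

Lemma slope_cvg phi b : slope_mono phi b ->
  slope phi b n.+1%:R @[n --> \oo] --> slope_sup phi b.
Proof.
move=> m; rewrite slope_supE//.
exact: (ereal_nondecreasing_cvgn (slope_nd _ _ m)).
Qed.

Lemma slope_sup_gtNy phi b : slope_mono phi b -> (-oo < slope_sup phi b)%E.
Proof.
move=> [bf gtN _]; apply: (lt_le_trans _ (slope_le_sup _ _ 1 ltr01)).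
exact/slope_gtNy/gtN.
Qed.

Lemma slopeD phi psi b c a : b \is a fin_num -> c \is a fin_num -> 0 < a ->
  (-oo < phi a)%E -> (-oo < psi a)%E ->
  slope (fun a => phi a + psi a)%E (b + c)%E a = (slope phi b a + slope psi c a)%E.
Proof.
rewrite /slope; case: b => // b _; case: c => // c _ a0.
have gy : (+oo * (a^-1)%:E = +oo :> \bar R)%E.
  by rewrite mulyr gtr0_sg ?invr_gt0// mul1e.
case: (phi a) => [r| |]//= _; case: (psi a) => [s| |]//= _.
- by rewrite -EFinD; congr EFin; ring.
- by rewrite ?addye ?addey// gy addey.
- by rewrite ?addye ?addey// gy addye.
- by rewrite ?addye ?addey// gy addye.
Qed.

Lemma slope_monoD phi psi b c : slope_mono phi b -> slope_mono psi c ->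
  slope_mono (fun a => phi a + psi a)%E (b + c)%E.
Proof.
move=> [bf p1 m1] [cf p2 m2]; split.
- by rewrite fin_numD bf.
- by move=> a a0; rewrite lteNye adde_eq_ninfty negb_or -!lteNye p1// p2.
- move=> a e a0 ae; have e0 := lt_le_trans a0 ae.
  by rewrite !slopeD ?p1 ?p2//; apply: leeD; [exact: m1|exact: m2].
Qed.

(** Both suprema are limits along the positive integers, and neither is [-oo], so the limits may be
    added. *)
Lemma slope_supD phi psi b c : slope_mono phi b -> slope_mono psi c ->
  slope_sup (fun a => phi a + psi a)%E (b + c)%E =
  (slope_sup phi b + slope_sup psi c)%E.
Proof.
move=> m1 m2; have m := slope_monoD _ _ _ _ m1 m2.
apply/(cvg_unique _ (slope_cvg _ _ m)) => //.
have [bf p1 _] := m1; have [cf p2 _] := m2.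
rewrite (_ : (fun n : nat => _) =
   (fun n : nat => slope phi b n.+1%:R + slope psi c n.+1%:R)%E); last first.
  by apply/funext => n; rewrite slopeD ?p1 ?p2.
apply: cvgeD; [|exact: slope_cvg|exact: slope_cvg].
by apply: ltninfty_adde_def; rewrite inE; apply: slope_sup_gtNy.
Qed.

End Slopes.

Section ConvexRay.
Context {R : realType} {d : nat}.
Implicit Types (g : 'rV[R]_d -> \bar R) (u v : 'rV[R]_d).

(** For [a < c], the point [v + a u] is the convex combination of [v + c u] and [v] with weights
    [a / c] and [1 - a / c]. *)
Lemma convex_slope_mono g v u : convex_ext g -> (forall y, -oo < g y)%E ->
  g v \is a fin_num -> slope_mono (fun a => g (v + a *: u)) (g v).
Proof.
move=> cg gN gv; split => // a c a0 ac; have c0 := lt_le_trans a0 ac.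
have [<-//|neq] := eqVneq a c.
have lac : 0 < a / c < 1.
  by rewrite divr_gt0//= ltr_pdivrMr// mul1r lt_neqAle neq.
have := cg (v + c *: u) v _ lac.
have -> : a / c *: (v + c *: u) + (1 - a / c) *: v = v + a *: u.
  rewrite scalerDr scalerA divfK ?gt_eqF// addrAC -scalerDl.
  by rewrite [_ + (1 - _)]addrC subrK scale1r.
rewrite /slope; move: (gN (v + c *: u)) (gN (v + a *: u)) gv.
have ca : forall x : R, 0 < x -> (+oo * (x^-1)%:E = +oo :> \bar R)%E.
  by move=> x x0; rewrite mulyr gtr0_sg ?invr_gt0// mul1e.
case: (g (v + c *: u)) => [r| |]//=; case: (g (v + a *: u)) => [s| |]//=;
  case: (g v) => [q| |]//= _ _ _.
- rewrite -!EFinM -!EFinD !lee_fin => h.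
  rewrite ler_pdivrMr// mulrAC -mulrA mulrC.
  nra.
- by move=> _; rewrite !addye// ca// leey.
- by move=> _; rewrite !addye// !ca// leey.
Qed.

(* The points [(1 - a / n) y + (a / n) (v + n u)] converge to [y + a u], so that
   closedness bounds the slopes at [y] by the supremum of those at [v]. *)
Lemma recession_slope_sup g v u : convex_ext g -> epi_closed g ->
  (forall y, -oo < g y)%E -> g v \is a fin_num ->
  recession g u = slope_sup (fun a => g (v + a *: u)) (g v).
Proof.
move=> cg clg gN gv; apply/eqP; rewrite eq_le; apply/andP; split; last first.
  by apply: ge_ereal_sup => _ [a [a0 ->]]; apply: ereal_sup_ubound; exists v, a.
have m := convex_slope_mono g v u cg gN gv.
have := slope_sup_gtNy _ _ m.
case ES : slope_sup => [S| |]// _; last by rewrite leey.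
(* A finite supremum [S] turns the slope bounds at [v] into affine bounds on [g] along the ray. *)
have bnd (n : nat) : (g (v + n.+1%:R *: u)%R <= (fine (g v) + n.+1%:R * S)%R%:E)%E.
  have := slope_le_sup (fun a : R => g (v + a *: u)) (g v) n.+1%:R (ltr0Sn _ _).
  rewrite ES /slope; move: (gN (v + n.+1%:R *: u)) gv.
  case: (g (v + _)) => [r| |]//=; case: (g v) => [q| |]//= _ _.
    by rewrite -EFinD lee_fin ler_pdivrMr// lee_fin; nra.
  by rewrite mulyr gtr0_sg ?invr_gt0// mul1e leye_eq.
apply: ge_ereal_sup => _ [y [a [gy a0 ->]]].
suff : (g (y + a *: u)%R <= (fine (g y) + a * S)%R%:E)%E.
  move: gy; case: (g y) => [q| |]//= _.
  move: (gN (y + a *: u)); case: (g _) => [r| |]//= _.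
  by rewrite -EFinD !lee_fin ler_pdivrMr//; nra.
pose l (n : nat) : R := a / n.+1%:R.
have l0 : l n @[n --> \oo] --> (0 : R).
  rewrite -(mulr0 a); apply: cvgM; first exact: cvg_cst.
  exact: cvg_harmonic.
pose z n := (1 - l n) *: y + l n *: v + a *: u.
(* Heights for the points [z n]: once [l n < 1], convexity and [bnd] give [g (z n) <= e n]. The term
   [a * S] is constant because [l n * n.+1%:R = a]. *)
pose e n := (1 - l n) * fine (g y) + l n * fine (g v) + a * S.
have zc : z n @[n --> \oo] --> y + a *: u.
  have -> : y + a *: u = (1 - 0) *: y + 0 *: v + a *: u.
    by rewrite subr0 scale1r scale0r addr0.
  apply: cvgD; last exact: cvg_cst.
  apply: cvgD; apply: cvgZr_tmp => //.
  by apply: cvgB => //; exact: cvg_cst.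
have ec : e n @[n --> \oo] --> fine (g y) + a * S.
  have -> : fine (g y) + a * S = (1 - 0) * fine (g y) + 0 * fine (g v) + a * S.
    by rewrite subr0 mul1r mul0r addr0.
  apply: cvgD; last exact: cvg_cst.
  apply: cvgD; apply: cvgMr_tmp => //.
  by apply: cvgB => //; exact: cvg_cst.
have : [set p : 'rV[R]_d * R | (g p.1 <= p.2%:E)%E] (y + a *: u, fine (g y) + a * S).
  have pc : (fun n : nat => (z n, e n)) @ \oo --> (y + a *: u, fine (g y) + a * S).
    exact: cvg_pair zc ec.
  apply: (closed_cvg _ clg _ _ pc).
  near=> n.
  have ln : 0 < l n < 1.
    rewrite divr_gt0//= ltr_pdivrMr// mul1r.
    near: n; exists (Num.truncn a) => // n /= an.
    by apply: (lt_le_trans (truncnS_gt _)); rewrite ler_nat.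
  have := cg (v + n.+1%:R *: u) y _ ln.
  have -> : l n *: (v + n.+1%:R *: u) + (1 - l n) *: y = z n.
    by rewrite /z scalerDr scalerA /l divfK// addrC addrA.
  move=> /=h; apply: (le_trans h).
  have := bnd n; move: (gN (v + n.+1%:R *: u)).
  move: gy; rewrite /e; case: (g y) => [q| |]//= _.
  case: (g (v + _)) => [r| |]//= _; rewrite !lee_fin => rb.
  have : l n * r <= l n * fine (g v) + a * S.
    have -> : a * S = l n * (n.+1%:R * S) by rewrite mulrA /l divfK.
    by rewrite -mulrDr ler_wpM2l// ltW//; case/andP: ln.
  lra.
by [].
Unshelve. all: by end_near. Qed.

End ConvexRay.

(** * Integrals of difference quotients *)

Section Xint.
Context {dT : measure_display} {T : measurableType dT} {R : realType}.
Variable m : {measure set T -> \bar R}.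
Implicit Types (D N : set T) (f g : T -> \bar R).

(* [f] is not assumed measurable: the integral of a nonnegative function is then a
   lower integral, and [recession] is known to be measurable only where the
   integrand is finite at the base point. *)
Lemma ge0_integral_setD_null D N f : measurable N -> m N = 0%E ->
  (forall x, D x -> (0 <= f x)%E) ->
  (\int[m]_(x in D) f x = \int[m]_(x in D `\` N) f x)%E.
Proof.
move=> mN N0 f0; have f0' x : (D `\` N) x -> (0 <= f x)%E by case=> /f0.
rewrite !ge0_integralE//; apply/eqP; rewrite eq_le; apply/andP; split.
  apply: ge_ereal_sup => _ [h hf <-].
  have mC := measurableC mN.
  (* The simple function is set to zero on [N]; being measurable, it keeps its integral because [N]
     is null. *)
  apply: ereal_sup_ubound; exists (proj_nnsfun h mC) => /=.
    move=> x; have := hf x; rewrite /patch /=.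
    rewrite mindicE /= in_setD in_setC.
    case: (x \in N) => /=; rewrite ?andbF ?mulr0 ?mulr1 ?andbT//.
  have <- : sintegral m (h \_ setT) = sintegral m h by rewrite patch_setT.
  rewrite -mrestrict -integral_nnsfun//.
  have := @ge0_negligible_integral _ _ _ m setT N (EFin \o h) mN measurableT.
  rewrite /= -!integral_nnsfun// => ->//.
  - by rewrite setTD.
  - exact/measurable_EFinP/measurable_funTS.
  - by move=> x _; rewrite lee_fin.
apply: ge_ereal_sup => _ [h hf <-].
apply: ereal_sup_ubound; exists h => // x.
apply: (le_trans (hf x)); rewrite /patch in_setD.
by case: ifPn => [/andP[->]//|_]; case: ifPn => // /[!inE] /f0.
Qed.

Lemma xint_setD_null D N f : measurable N -> m N = 0%E ->
  xint m D f = xint m (D `\` N) f.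
Proof.
by move=> mN N0; rewrite /xint -!(ge0_integral_setD_null D N).
Qed.

Lemma eq_xint D f g : {in D, f =1 g} -> xint m D f = xint m D g.
Proof.
move=> fg; rewrite /xint; congr (if (_ < _)%E then (_ - _)%E else _);
  by apply: eq_integral => x xD; rewrite ?funeposE ?funenegE fg.
Qed.

Lemma xint_y D f : (\int[m]_(x in D) (f^\+)%E x = +oo)%E -> xint m D f = +oo%E.
Proof. by rewrite /xint => ->; rewrite ltxx. Qed.

Lemma xint_integral D f : (\int[m]_(x in D) (f^\+)%E x < +oo)%E ->
  xint m D f = (\int[m]_(x in D) f x)%E.
Proof. by rewrite /xint => ->; rewrite [RHS]integralE. Qed.

(** With a finite negative part, the difference is itself [+oo] when the positive part has infinite
    integral, so it agrees with the default value. *)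
Lemma xint_fneg D f : (\int[m]_(x in D) (f^\-)%E x < +oo)%E ->
  xint m D f = (\int[m]_(x in D) (f^\+)%E x - \int[m]_(x in D) (f^\-)%E x)%E.
Proof.
move=> fn; rewrite /xint; case: ifPn => //; rewrite ltey negbK => /eqP ->.
have : (0 <= \int[m]_(x in D) (f^\-)%E x)%E by apply: integral_ge0.
by case: (integral _ _ _) fn.
Qed.

Lemma xint_gtNy D f : (\int[m]_(x in D) (f^\-)%E x < +oo)%E -> (-oo < xint m D f)%E.
Proof.
move=> fn; rewrite /xint; case: ifPn => // fp.
have p0 : (0 <= \int[m]_(x in D) (f^\+)%E x)%E by apply: integral_ge0.
have n0 : (0 <= \int[m]_(x in D) (f^\-)%E x)%E by apply: integral_ge0.
by move: fp fn p0 n0; do 2 case: (integral _ _ _) => //=; move=> *; rewrite ltNyr.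
Qed.

Variable D : set T.
Hypothesis mD : measurable D.

Lemma integrable_posneg f : measurable_fun D f ->
  (\int[m]_(x in D) (f^\+)%E x < +oo)%E -> (\int[m]_(x in D) (f^\-)%E x < +oo)%E ->
  m.-integrable D f.
Proof.
move=> mf fp fn; apply/integrableP; split => //.
rewrite (_ : (fun x => `|f x|%E) = (fun x => f^\+ x + f^\- x)%E); last first.
  by apply/funext => x; rewrite -/((abse \o f) x) fune_abse.
rewrite ge0_integralD//; first exact: lte_add_pinfty.
- exact: measurable_funepos.
- exact: measurable_funeneg.
Qed.

Lemma xint_gtNyP f : measurable_fun D f -> (-oo < xint m D f)%E ->
  m.-integrable D f \/ (\int[m]_(x in D) (f^\+)%E x = +oo)%E.
Proof.
move=> mf; rewrite /xint; case: ifPn => [fp fn|]; last first.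
  by rewrite ltey negbK => /eqP; right.
left; apply: integrable_posneg => //.
by rewrite ltey; apply: contraTneq fn => ->; rewrite addeNy.
Qed.

Lemma xint_fin_integrable f : measurable_fun D f -> xint m D f \is a fin_num ->
  m.-integrable D f.
Proof.
move=> mf fin.
have [|//|/xint_y E] := xint_gtNyP _ mf; last by rewrite E in fin.
by move: fin; rewrite fin_numE lteNye => /andP[].
Qed.

Lemma integrable_xint f : m.-integrable D f ->
  xint m D f = (\int[m]_(x in D) f x)%E.
Proof. by move=> fi; apply/xint_integral/integral_funepos_lt_pinfty. Qed.

(** Monotonicity survives the convention: either the positive part of [g], hence that of [f], has
    finite integral, or the right side is [+oo]. *)
Lemma le_xint f g : measurable_fun D f -> measurable_fun D g ->
  (forall x, D x -> (f x <= g x)%E) -> (xint m D f <= xint m D g)%E.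
Proof.
move=> mf mg fg.
have fgp : (\int[m]_(x in D) (f^\+)%E x <= \int[m]_(x in D) (g^\+)%E x)%E.
  apply: ge0_le_integral => //; try exact: measurable_funepos.
  by move=> x Dx; rewrite !funeposE; apply: le_max2 => //; exact: fg.
have fgn : (\int[m]_(x in D) (g^\-)%E x <= \int[m]_(x in D) (f^\-)%E x)%E.
  apply: ge0_le_integral => //; try exact: measurable_funeneg.
  by move=> x Dx; rewrite !funenegE; apply: le_max2 => //; rewrite leeN2; exact: fg.
have [gp|] := boolP (\int[m]_(x in D) (g^\+)%E x < +oo)%E.
  by rewrite /xint gp (le_lt_trans fgp gp); apply: leeB.
by rewrite ltey negbK => /eqP /xint_y ->; rewrite leey.
Qed.

End Xint.

Lemma cvg_maxe {R : realType} (u : nat -> \bar R) (l x : \bar R) :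
  u @ \oo --> l -> maxe (u n) x @[n --> \oo] --> maxe l x.
Proof.
move=> ul; move: (@max_continuous _ (\bar R) (l, x)) => /continuous2_cvg.
by apply => //; exact: cvg_cst.
Qed.

Section XintSlope.
Context {dT : measure_display} {T : measurableType dT} {R : realType}.
Variables (m : {measure set T -> \bar R}) (D : set T).
Hypothesis mD : measurable D.
Variables (phi : R -> T -> \bar R) (b : T -> \bar R).
Hypothesis mphi : forall a : R, 0 < a -> measurable_fun D (phi a).
Hypothesis mb : measurable_fun D b.
Hypothesis mono : forall t, D t -> slope_mono (phi^~ t) (b t).
Hypothesis bfin : xint m D b \is a fin_num.
Hypothesis phiN : forall a : R, 0 < a -> (-oo < xint m D (phi a))%E.

Let q a t := slope (phi^~ t) (b t) a.

Lemma measurable_slope a : 0 < a -> measurable_fun D (q a).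
Proof.
move=> a0; apply: emeasurable_funM; last exact: measurable_cst.
by apply: emeasurable_funB => //; exact: mphi.
Qed.

Let b_int : m.-integrable D b.
Proof. exact: xint_fin_integrable. Qed.

Lemma slope_integrable a : 0 < a -> m.-integrable D (phi a) ->
  m.-integrable D (q a) /\
  (\int[m]_(t in D) q a t)%E =
    slope (fun a => xint m D (phi a)) (xint m D b) a.
Proof.
move=> a0 phi_int; have I := integrableB mD phi_int b_int; split.
  exact: (integrableZr mD (a^-1) I).
rewrite /slope !integrable_xint//.
by rewrite -integralB// -integralZr.
Qed.

(** The bound [phi a <= a%:E * (q a)^\+ + b^\+], with [b] integrable, passes the infinite integral
    from [phi a] to its slope. *)
Lemma slope_infinite a : 0 < a -> (\int[m]_(t in D) ((phi a)^\+)%E t = +oo)%E ->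
  (\int[m]_(t in D) ((q a)^\+)%E t = +oo)%E /\
  slope (fun a => xint m D (phi a)) (xint m D b) a = +oo%E.
Proof.
move=> a0 pinf; split; last first.
  rewrite /slope (xint_y _ _ _ pinf); move: bfin; case: (xint _ _ _) => //= r _.
  by rewrite addye// mulyr gtr0_sg ?invr_gt0// mul1e.
apply: contrapT => /eqP; rewrite -ltey => qfin.
have : (\int[m]_(t in D) ((phi a)^\+)%E t <=
   \int[m]_(t in D) (a%:E * (q a)^\+ t + b^\+ t))%E.
  apply: ge0_le_integral => //.
  - exact/measurable_funepos/mphi.
  - apply: emeasurable_funD; last exact: measurable_funepos.
    apply: measurable_funeM; exact/measurable_funepos/measurable_slope.
  - move=> t Dt; have [btf pN _] := mono t Dt.
    have q0 : (0 <= (q a)^\+ t)%E by [].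
    have b0 : (0 <= b^\+ t)%E by [].
    have : (phi a t <= a%:E * (q a)^\+ t + b^\+ t)%E.
      have h1 : (q a t <= (q a)^\+ t)%E by rewrite funeposE le_max lexx.
      have h2 : (b t <= b^\+ t)%E by rewrite funeposE le_max lexx.
      apply: le_trans (leeD (lee_wpmul2l _ h1) h2); last by rewrite lee_fin ltW.
      rewrite /q /slope; move: btf (pN a a0); case: (b t) => //= r _.
      case: (phi a t) => [s| |]//= _.
        by rewrite -!EFinM -EFinD lee_fin mulrCA divff ?gt_eqF// mulr1 subrK.
      by rewrite addye// mulyr gtr0_sg ?invr_gt0// mul1e gt0_muley ?lte_fin.
    move=> h; rewrite funeposE ge_max h /=.
    by apply: adde_ge0 => //; apply: mule_ge0 => //; rewrite lee_fin ltW.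
rewrite pinf leye_eq ge0_integralD//; first last.
- exact: measurable_funepos.
- apply: measurable_funeM; exact/measurable_funepos/measurable_slope.
- by move=> t Dt; apply: mule_ge0 => //; rewrite lee_fin ltW.
rewrite ge0_integralZl ?lee_fin ?(ltW a0)//; last first.
  exact/measurable_funepos/measurable_slope.
apply/negP; rewrite -ltey; apply: lte_add_pinfty.
  by apply: lte_mul_pinfty => //; rewrite lee_fin ltW.
exact: integral_funepos_lt_pinfty.
Qed.

(** Since the integral of [phi a] is not [-oo], either [phi a] is integrable and linearity applies,
    or both sides are [+oo]. *)
Lemma xint_slopeE a : 0 < a ->
  xint m D (q a) = slope (fun a => xint m D (phi a)) (xint m D b) a.
Proof.
move=> a0; have [I|Y] := xint_gtNyP _ _ mD _ (mphi a a0) (phiN a a0).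
  by have [qi <-] := slope_integrable a a0 I; rewrite integrable_xint.
by have [qi ->] := slope_infinite a a0 Y; rewrite xint_y.
Qed.

Lemma xint_slope_mono : slope_mono (fun a => xint m D (phi a)) (xint m D b).
Proof.
split => // a c a0 ac; have c0 := lt_le_trans a0 ac.
rewrite -!xint_slopeE//; apply: le_xint => //; [exact: measurable_slope..|].
by move=> t Dt; have [_ _] := mono t Dt; exact.
Qed.

(* The slopes may take the value [+oo] on a null set, where differences of slopes
   are meaningless; positive parts are handled by monotone convergence, and
   negative parts by domination by the negative part of the first slope. *)
Lemma xint_slope_sup : xint m D (fun t => slope_sup (phi^~ t) (b t)) =
  slope_sup (fun a => xint m D (phi a)) (xint m D b).
Proof.
set Q := fun t => slope_sup (phi^~ t) (b t).
pose s (n : nat) := q n.+1%:R.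
have ms n : measurable_fun D (s n) by exact: measurable_slope.
have sQ t : D t -> s ^~ t @ \oo --> Q t by move=> Dt; exact: slope_cvg (mono t Dt).
have mQ : measurable_fun D Q by exact: (emeasurable_fun_cvg _ _ ms sQ).
have sQle n t : (s n t <= Q t)%E by exact: slope_le_sup.
have s_nd t : D t -> nondecreasing_seq (s ^~ t) by move=> Dt; exact: slope_nd (mono t Dt).
have posle (x y : \bar R) : (x <= y)%E -> (maxe x 0 <= maxe y 0)%E.
  by move=> xy; apply: le_max2.
(* One infinite positive part makes both sides [+oo]; otherwise every slope at a positive integer is
   integrable. *)
have [[n /= Yn]|/forallNP noY] :=
    pselect (exists n : nat, (\int[m]_(t in D) ((phi n.+1%:R)^\+)%E t = +oo)%E).
  have [qi slope_y] := slope_infinite _ (ltr0Sn _ n) Yn.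
  rewrite xint_y; last first.
    apply/eqP; rewrite -leye_eq -qi; apply: ge0_le_integral => //.
    - exact: measurable_funepos (ms n).
    - exact: measurable_funepos.
    - by move=> t Dt; rewrite !funeposE; apply: posle; exact: sQle.
  by apply/esym/eqP; rewrite -leye_eq -slope_y; exact: slope_le_sup.
have sI n : m.-integrable D (s n).
  have [I|/noY//] := xint_gtNyP _ _ mD _ (mphi _ (ltr0Sn _ n)) (phiN _ (ltr0Sn _ n)).
  by have [] := slope_integrable _ (ltr0Sn _ n) I.
have s0fin := integral_funeneg_lt_pinfty mD (sI 0%N).
have Qneg t : D t -> (Q^\- t <= (s 0%N)^\- t)%E.
  by move=> Dt; rewrite !funenegE; apply: posle; rewrite leeN2.
have Qfin : (\int[m]_(t in D) Q^\- t < +oo)%E.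
  apply: le_lt_trans s0fin; apply: ge0_le_integral => //; exact: measurable_funeneg.
rewrite xint_fneg//.
apply/esym/(cvg_unique _ (slope_cvg _ _ xint_slope_mono)) => //.
rewrite (_ : (fun n : nat => _) = (fun n : nat =>
  \int[m]_(t in D) (s n)^\+ t - \int[m]_(t in D) (s n)^\- t)%E); last first.
  apply/funext => n; rewrite -xint_slopeE// (integrable_xint _ _ _ _ (sI n))//; exact: integralE.
apply: cvgeB.
(* The limit of the negative parts is finite, which rules out [+oo - +oo]. *)
- have nneg : (0 <= \int[m]_(t in D) Q^\- t)%E by exact: integral_ge0.
  have ppos : (0 <= \int[m]_(t in D) Q^\+ t)%E by exact: integral_ge0.
  by move: Qfin nneg ppos; do 2 case: (integral _ _ _).
- apply: cvg_toP => //.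
  + apply: ereal_nondecreasing_is_cvgn => i j ij; apply: ge0_le_integral => //.
    * exact: measurable_funepos.
    * exact: measurable_funepos.
    * by move=> t Dt; rewrite !funeposE; apply: posle; exact: s_nd.
  + rewrite -monotone_convergence//.
    * apply: eq_integral => t; rewrite inE => Dt; apply/cvg_lim => //.
      rewrite (_ : (fun n : nat => _) = (fun n : nat => maxe (s n t) 0)); last first.
        by apply/funext => n; rewrite funeposE.
      rewrite funeposE; by apply: cvg_maxe; exact: sQ.
    * by move=> n; exact: measurable_funepos.
    * by move=> t Dt i j ij; rewrite !funeposE; apply: posle; exact: s_nd.
- apply: (@dominated_cvg _ _ _ m D mD (fun n => (s n)^\-)%E Q^\-%E (s 0%N)^\-%E) => //.
  + by move=> n; exact: measurable_funeneg.
  + move=> t Dt; rewrite (_ : (fun n : nat => _) = (fun n : nat => maxe (- s n t) 0)%E); last first.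
      by apply/funext => n; rewrite funenegE.
    by rewrite funenegE; apply: cvg_maxe; apply: cvgeN; exact: sQ.
  + move=> t Dt; have [bf pN _] := mono t Dt.
    have := slope_gtNy (phi^~ t) (b t) 1 bf ltr01 (pN _ ltr01); rewrite -/(q 1 t) -/(s 0%N t).
    by rewrite funenegE; case: (s 0%N t) => [r| |]//= _; [rewrite maxEle; case: ifP|rewrite maxNye].
  + exact: integrable_funeneg.
  + move=> n t Dt; rewrite gee0_abs// !funenegE; apply: posle; rewrite leeN2.
    exact: s_nd.
Qed.

End XintSlope.

(** * Measurability of processes and normal integrands *)

Section Joint.
Context {dO : measure_display} {Omega : measurableType dO} {R : realType}.

(** [X] is the pointwise limit of its values at grid times approaching [t] from the left; each
    approximation is constant in time on the cells of a countable grid. *)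
Lemma leftcont_measurable (X : Omega -> R -> R) :
  (forall t, measurable_fun setT (X ^~ t)) ->
  (forall w t, X w s @[s --> t^'-] --> X w t) ->
  measurable_fun setT (fun p : Omega * R => X p.1 p.2).
Proof.
move=> mX lX.
(* The [- 1] keeps [s n t] strictly below [t] even when [t] is a grid point; the distance stays
   below [2 / n.+1%:R]. *)
pose s (n : nat) (t : R) : R := ((Num.floor (t * n.+1%:R))%:~R - 1) / n.+1%:R.
apply: (@measurable_fun_cvg _ (Omega * R)%type R setT
  (fun n p => X p.1 (s n p.2)) (fun p => X p.1 p.2)).
- move=> n _ B mB; rewrite setTI.
  pose E (k : int) := `[(k%:~R : R) / n.+1%:R, (k + 1)%:~R / n.+1%:R[%classic.
  rewrite (_ : _ @^-1` B = \bigcup_(k : int)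
    ((X ^~ ((k%:~R - 1) / n.+1%:R)) @^-1` B `*` E k)); last first.
    apply/seteqP; split => [[w t] /= Bw|[w t] [k _ [/= Bw]]].
      exists (Num.floor (t * n.+1%:R)) => //; split => //=.
      have := floor_itv (t * n.+1%:R).
      by rewrite /E /= in_itv /= ler_pdivrMr// ltr_pdivlMr.
    rewrite /E /= in_itv /= ler_pdivrMr// ltr_pdivlMr// => /floor_def tk.
    by rewrite /s tk.
  apply: countable_bigcupT_measurable; first exact: countableP.
  move=> k; apply: measurableX; last exact: measurable_itv.
  by rewrite -[X in measurable X]setTI; exact: mX.
- move=> [w t] _ /=; apply: cvg_comp (lX w t).
  move=> A [e /= e0 eA].
  exists (Num.truncn (2 / e)) => // n /= ne.
  have n0 : (0 : R) < n.+1%:R by [].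
  have n2 : 2 / n.+1%:R < e.
    rewrite ltr_pdivrMr// mulrC -ltr_pdivrMr//.
    by apply: (lt_le_trans (truncnS_gt _)); rewrite ler_nat.
  have /andP[f1 f2] := floor_itv (t * n.+1%:R).
  rewrite intrD /= in f2.
  have st : s n t < t.
    by rewrite /s ltr_pdivrMr//; lra.
  have st2 : t - 2 / n.+1%:R < s n t.
    rewrite /s ltr_pdivlMr// mulrBl divfK//; lra.
  apply: eA => //; rewrite /ball /= ltr_norml; apply/andP; split; first lra.
  by apply: lt_trans n2; rewrite ltrBlDr addrC -ltrBlDr.
Qed.

Lemma predictable_measurable (F : R -> set (set Omega)) :
  (forall t, 0 <= t -> F t `<=` measurable) ->
  predictable_sets F `<=` (measurable : set (set (Omega * R))).
Proof.
move=> Fm; apply: smallest_sub; first exact: sigma_algebra_measurable.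
move=> _ [X [B [aX lX mB ->]]].
(* Generators are adapted at nonnegative times and left-continuous at positive ones only; freezing
   them before time 0 yields a process left-continuous on the whole line. *)
pose Y w t := if t <= 0 then X w 0 else X w t.
have mY : measurable_fun setT (fun p : Omega * R => Y p.1 p.2).
  apply: leftcont_measurable => [t|w t]; rewrite /Y.
    have aX' (s : R) : 0 <= s -> measurable_fun setT (X ^~ s).
      by move=> s0 _ C mC; rewrite setTI; apply: (Fm s) => //; exact: aX.
    by case: (boolP (t <= 0)) => [_|]; [exact: aX'|rewrite -ltNge => /ltW; exact: aX'].
  case: (boolP (t <= 0)) => [t0|].
    apply: cvg_near_cst; near=> s.
    by have -> : s <= 0 by apply: ltW; apply: lt_le_trans t0; near: s; exact: nbhs_left_lt.
  rewrite -ltNge => t0; apply: cvg_trans (lX w t t0).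
  apply: near_eq_cvg; near=> s; rewrite ifN// -ltNge; near: s.
  exact: nbhs_left_gt.
rewrite (_ : mkset _ = (setT `*` `[0, +oo[%classic) `&`
   ((fun p : Omega * R => Y p.1 p.2) @^-1` B)).
  apply: measurableI; first by apply: measurableX => //; exact: measurable_itv.
  by rewrite -[X in measurable X]setTI; exact: mY.
apply/seteqP; split => [[w t] /= [t0 BX]|[w t] /= [[_]]]; rewrite /Y.
  rewrite in_itv /= t0; split => //.
  by case: ifPn => // t0'; have -> : 0 = t by apply/eqP; rewrite eq_le t0.
rewrite in_itv /= andbT => t0; split => //; move: b.
by case: ifPn => // t0'; have -> : 0 = t by apply/eqP; rewrite eq_le t0.
Unshelve. all: by end_near. Qed.

(** Sections of a measurable set have masses depending measurably on [w], since each [mu w] is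
    finite; simple functions increasing to [phi] carry this over to the integrals. *)
Lemma measurable_integral_kernel (mu : Omega -> {measure set R -> \bar R})
    (D : set R) (phi : Omega * R -> \bar R) :
  (forall A, measurable A -> measurable_fun setT (mu ^~ A)) ->
  measurable D -> (forall w, (mu w setT < +oo)%E) ->
  measurable_fun setT phi -> (forall p, 0 <= phi p)%E ->
  measurable_fun setT (fun w => \int[mu w]_(t in D) phi (w, t))%E.
Proof.
move=> mmu mD mufin mphi phi0.
pose k : R.-ker Omega ~> R := HB.pack mu (isKernel.Build _ _ _ _ _ mu mmu).
pose psi := (phi \_ (setT `*` D)).
have mpsi : measurable_fun setT psi.
  apply/(measurable_restrictT phi (measurableX measurableT mD)).
  exact: measurable_funTS.
have psi0 p : (0 <= psi p)%E by rewrite /psi /patch; case: ifP.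
rewrite (_ : (fun w => _) = (fun w => \int[mu w]_t psi (w, t))%E); last first.
  apply/funext => w; rewrite integral_mkcond; apply: eq_integral => t _.
  by rewrite /psi /patch in_setX in_setT.
pose k_ := nnsfun_approx measurableT mpsi.
apply: (measurable_fun_xsection_integral _ mu k_).
- by move=> a b ab; exact/nd_nnsfun_approx.
- by move=> z; exact/cvg_nnsfun_approx.
- move=> n r.
  have [] // := @measurable_prod_subset_xsection_kernel _ _ _ _ R k setT measurableT _
    (k_ n @^-1` [set r]) (measurable_funPTI (k_ n) (measurable_set1 r)).
    move=> w; exists (fine (mu w setT) + 1) => A mA.
    rewrite /mrestr setIT EFinD fineK ?ge0_fin_numE//.
    apply: (@le_lt_trans _ _ (mu w setT)); first by apply: le_measure; rewrite ?inE.
    by rewrite -[X in (X < _)%E]adde0 lteD2lE ?ge0_fin_numE// lte_fin.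
  move=> _; congr (measurable_fun _ _).
  by apply/funext => w /=; rewrite /mrestr /= setIT.
Qed.

End Joint.

Section Vectors.
Context {R : realType} {d : nat}.
Implicit Types x y v : 'rV[R]_d.

Lemma vnorm_ge0 x : 0 <= vnorm x.
Proof. by apply: sumr_ge0. Qed.

Lemma coord_le_vnorm x i : `|x ord0 i| <= vnorm x.
Proof. by rewrite /vnorm (bigD1 i)//= lerDl sumr_ge0. Qed.

Lemma vnormD x y : vnorm (x + y) <= vnorm x + vnorm y.
Proof.
by rewrite /vnorm -big_split/=; apply: ler_sum => i _; rewrite mxE ler_normD.
Qed.

Lemma vnormZ (a : R) x : vnorm (a *: x) = `|a| * vnorm x.
Proof. by rewrite /vnorm mulr_sumr; apply: eq_bigr => i _; rewrite mxE normrM. Qed.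

Lemma dotv_dist v x y (e : R) : (forall i, `|v ord0 i - x ord0 i| <= e) ->
  `|dotv v y - dotv x y| <= e * vnorm y.
Proof.
move=> vx; rewrite /dotv -sumrB /vnorm mulr_sumr.
apply: (le_trans (ler_norm_sum _ _ _)); apply: ler_sum => i _.
by rewrite -mulrBl normrM ler_wpM2r.
Qed.

Lemma dotv_le x y : `|dotv x y| <= vnorm x * vnorm y.
Proof.
have := @dotv_dist x 0 y (vnorm x).
have -> : dotv 0 y = 0 by rewrite /dotv big1// => i _; rewrite mxE mul0r.
by rewrite subr0; apply => i; rewrite mxE subr0 coord_le_vnorm.
Qed.

End Vectors.

(** * Normal integrands: compositions and conjugates *)

Section NormalIntegrands.
Context {dS : measure_display} {S : measurableType dS} {R : realType} {d : nat}.
Implicit Types (g : S -> 'rV[R]_d -> \bar R) (x y : S -> 'rV[R]_d).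

(** Effros measurability of the epigraphical mapping, for the full sigma-algebra of [S]. *)
Definition measurable_epi g := forall O : set ('rV[R]_d * R)%type, open O ->
  measurable [set s | exists q, O q /\ (g s q.1 <= q.2%:E)%E].

Definition measurable_coords x := forall i, measurable_fun setT (fun s => x s ord0 i).

Lemma measurable_vnorm x : measurable_coords x ->
  measurable_fun setT (fun s => vnorm (x s)).
Proof.
move=> mx; apply: measurable_sum => i.
by apply: measurableT_comp => //; exact: mx.
Qed.

Lemma measurable_dotv x y : measurable_coords x -> measurable_coords y ->
  measurable_fun setT (fun s => dotv (x s) (y s)).
Proof.
by move=> mx my; apply: measurable_sum => i; apply: measurable_funM; [exact: mx|exact: my].
Qed.

(** Centres of a countable family of balls of radius [i.2.+1%:R^-1]; quantifying over it keeps the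
    descriptions of level sets below countable. *)
Definition rat_center (i : 'rV[rat]_d * rat * nat) : 'rV[R]_d * R :=
  (map_mx ratr i.1.1, ratr i.1.2).

Definition rat_ball (i : 'rV[rat]_d * rat * nat) : set ('rV[R]_d * R) :=
  ball (rat_center i) (i.2.+1%:R^-1).

Lemma rat_ballP i (q : 'rV[R]_d * R) : rat_ball i q <->
  (forall j, `|(rat_center i).1 ord0 j - q.1 ord0 j| < i.2.+1%:R^-1) /\
  `|(rat_center i).2 - q.2| < i.2.+1%:R^-1.
Proof.
split=> [[/= [_ b1] b2]|[b1 b2]]; split => //; first by move=> j; exact: b1.
by split => //= k j; rewrite [k]ord1; exact: b1.
Qed.

Lemma rat_ball_open i : open (rat_ball i).
Proof. exact: ball_open. Qed.

Lemma rat_ball_dense (q : 'rV[R]_d * R) (n : nat) :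
  exists2 i, i.2 = n & rat_ball i q.
Proof.
have near_rat (z : R) : exists r : rat, `|ratr r - z| < n.+1%:R^-1.
  have [r] := @rat_in_itvoo R (z - n.+1%:R^-1) (z + n.+1%:R^-1) ltac:(by rewrite ltrD2l gtrN).
  rewrite in_itv /= => /andP[r1 r2]; exists r.
  by rewrite ltr_norml ltrBrDr addrC r1 ltrBlDr addrC.
have [v vP] := choice (fun j => near_rat (q.1 ord0 j)).
have [r rP] := near_rat q.2.
exists (\row_j v j, r, n) => //; apply/rat_ballP; split => //= j.
by rewrite !mxE; exact: vP.
Qed.

Lemma measurable_rat_ball i x (c : S -> R) : measurable_coords x ->
  measurable_fun setT c -> measurable [set s | rat_ball i (x s, c s)].
Proof.
move=> mx mc.
have mdist (z : R) (f : S -> R) : measurable_fun setT f ->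
    measurable [set s | `|z - f s| < i.2.+1%:R^-1].
  move=> mf; rewrite -[X in measurable X]setTI.
  apply: (measurable_fun_ltr _ _ measurableT) => //.
  by apply: measurableT_comp => //; apply: measurable_funB.
rewrite (_ : mkset _ =
  (\bigcap_(j in [set: 'I_d]) [set s | `|(rat_center i).1 ord0 j - x s ord0 j| < i.2.+1%:R^-1])
  `&` [set s | `|(rat_center i).2 - c s| < i.2.+1%:R^-1]).
  apply: measurableI; last exact: mdist.
  by apply: fin_bigcap_measurable => // j _; apply: mdist; exact: mx.
by apply/seteqP; split => s /= => [/rat_ballP[h1 h2]|[h1 h2]];
  [split => // j _; exact: h1|apply/rat_ballP; split => // j; exact: h1].
Qed.

Lemma emeasurable_fun_gt (f : S -> \bar R) :
  (forall c : R, measurable [set s | (c%:E < f s)%E]) -> measurable_fun setT f.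
Proof.
move=> mf; move=> mT; apply: (measurability _ (ErealGenOInfty.measurableE R)) => //.
move=> _ [_ [c ->] <-]; rewrite setTI.
have -> : f @^-1` `]c%:E, +oo[%classic = [set s | (c%:E < f s)%E].
  by apply/seteqP; split => s /=; rewrite in_itv /= andbT.
exact: mf.
Qed.

(** As the epigraph is closed, [g s (x s) <= c] holds exactly when, for every [n], some rational
    ball of index [n] contains [(x s, c)] and meets the epigraph. *)
Lemma measurable_normal_comp g x : measurable_epi g ->
  (forall s, epi_closed (g s)) -> measurable_coords x ->
  measurable_fun setT (fun s => g s (x s)).
Proof.
move=> mg clg mx; apply: emeasurable_fun_gt => c.
rewrite (_ : mkset _ = ~` \bigcap_n \bigcup_(i in [set i | i.2 = n])
    ([set s | rat_ball i (x s, c)] `&`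
     [set s | exists q, rat_ball i q /\ (g s q.1 <= q.2%:E)%E])).
  apply: measurableC; apply: bigcapT_measurable => n.
  rewrite bigcup_mkcond; apply: countable_bigcupT_measurable; first exact: countableP.
  move=> i; case: ifP => // _; apply: measurableI; first exact: measurable_rat_ball.
  exact/mg/rat_ball_open.
apply/seteqP; split => s /=.
  move=> cg h; move: cg; rewrite ltNge => /negP; apply.
  apply: contrapT => ncg.
  have /= : nbhs (x s, c) (~` [set p : 'rV[R]_d * R | (g s p.1 <= p.2%:E)%E]).
    by apply: open_nbhs_nbhs; split => //; rewrite openC; exact: clg.
  move=> /nbhs_ballP[e /= e0 be].
  have [i /= ie [bi [q [bq gq]]]] := h (Num.truncn (2 / e)) I.
  have ei : 2 / i.2.+1%:R <= e.
    rewrite ler_pdivrMr// mulrC -ler_pdivrMr// ie.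
    exact/ltW/truncnS_gt.
  apply: (be q) gq; apply: (@le_ball _ _ _ (i.2.+1%:R^-1 + i.2.+1%:R^-1)); last first.
    apply: (@ball_triangle _ _ (rat_center i)) => //; exact: ball_sym.
  by move: ei; rewrite mulr_natl mulr2n.
move=> h; rewrite ltNge; apply/negP => gc; apply: h => n _.
have [i ni bi] := rat_ball_dense (x s, c) n.
by exists i => //; split => //; exists (x s, c).
Qed.

(** The conjugate exceeds [c] exactly when a rational ball meets the epigraph and the affine
    expression stays above [c] on that ball with a margin measurable in [s]. *)
Lemma measurable_conjugate g y : measurable_epi g -> measurable_coords y ->
  measurable_fun setT (fun s => conjugate g s (y s)).
Proof.
move=> mg my; apply: emeasurable_fun_gt => c.
have below (D Dz V r a e : R) : r - a < e ->
    2 * (V + 1) / e^-1 < Dz - a - c -> - (e * V) <= D - Dz ->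
    c < D - r - e * (V + 1).
  by rewrite invrK => *; lra.
have above (D Dz V r a e : R) : - e < r - a -> D - Dz <= e * V ->
    c < D - r - e * (V + 1) -> c < Dz - a.
  by move=> *; lra.
(* A lower bound of [dotv q.1 (y s) - q.2] over the points [q] of the ball [i]. *)
pose low i s := dotv (rat_center i).1 (y s) - (rat_center i).2 -
  i.2.+1%:R^-1 * (vnorm (y s) + 1).
rewrite (_ : mkset _ = \bigcup_(i in [set: 'rV[rat]_d * rat * nat])
    ([set s | c < low i s] `&`
     [set s | exists q, rat_ball i q /\ (g s q.1 <= q.2%:E)%E])).
  apply: countable_bigcupT_measurable; first exact: countableP.
  move=> i; apply: measurableI; last exact/mg/rat_ball_open.
  rewrite -[X in measurable X]setTI; apply: (measurable_fun_ltr _ _ measurableT) => //.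
  apply: measurable_funB; first apply: measurable_funB => //.
    by apply: measurable_dotv => // j; exact: measurable_cst.
  by apply: measurable_funM => //; apply: measurable_funD => //; exact: measurable_vnorm.
apply/seteqP; split => s /=.
  move=> /ereal_sup_gt[_ [z _ <-] cz].
  have [a ga ca] : exists2 a : R, (g s z <= a%:E)%E & c < dotv z (y s) - a.
    move: cz; case: (g s z) => [r| |] //= cz.
      by exists r => //; rewrite -EFinB lte_fin in cz.
    (* Where [g s z = -oo] every height lies in the epigraph; this one leaves a margin of 1. *)
    by exists (dotv z (y s) - c - 1); [exact: leNye|clear cz; lra].
  pose dl := dotv z (y s) - a - c.
  have dl0 : 0 < dl by rewrite /dl; lra.
  have V0 := vnorm_ge0 (y s).
  (* Passing from [(z, a)] to the centre and then to [low] costs at most [2 * (vnorm (y s) + 1)]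
     times the radius, which must stay below [dl]. *)
  have [i ni bi] := rat_ball_dense (z, a) (Num.truncn (2 * (vnorm (y s) + 1) / dl)).
  exists i => //; split; last by exists (z, a).
  have /rat_ballP[/= b1 b2] := bi.
  have := @dotv_dist _ _ (rat_center i).1 z (y s) (i.2.+1%:R^-1) (fun j => ltW (b1 j)).
  have : 2 * (vnorm (y s) + 1) * i.2.+1%:R^-1 < dl.
    rewrite ltr_pdivrMr// [dl * _]mulrC -ltr_pdivrMr// ni.
    exact: truncnS_gt.
  move: b2; rewrite /low /dl /= ltr_norml ler_norml => /andP[b3 b4] b5 /andP[b6 b7].
  by apply: (below _ _ _ _ _ _ b4 _ b6); rewrite invrK.
move=> [i _ [cl [q [/rat_ballP[b1 b2] gq]]]].
have := @dotv_dist _ _ (rat_center i).1 q.1 (y s) (i.2.+1%:R^-1) (fun j => ltW (b1 j)).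
move: b2; rewrite ltr_norml ler_norml => /andP[b3 b4] /andP[b6 b7].
apply: (@lt_le_trans _ _ (dotv q.1 (y s) - q.2)%:E).
  by rewrite lte_fin; exact: above b3 b7 cl.
apply: (@le_trans _ _ ((dotv q.1 (y s))%:E - g s q.1)%E).
  by rewrite EFinB leeB.
by apply: ereal_sup_ubound; exists q.1.
Qed.

End NormalIntegrands.

(** * Paths of bounded variation *)

Section Paths.
Context {R : realType} {d : nat}.
Implicit Types (p q : R -> 'rV[R]_d).

Lemma vnorm_diff_le_TV p (s t : R) : s <= t -> ((vnorm (p t - p s))%:E <= TV p)%E.
Proof.
move=> st; apply: ereal_sup_ubound.
exists 1%N, (fun i => if i is 0%N then s else t); split => [[]//|].
by rewrite big_ord_recl big_ord0 addr0.
Qed.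

Lemma in_X_bounded (T : R) p : in_X T p -> exists C, forall t, vnorm (p t) <= C.
Proof.
move=> [_ tv p0 _]; exists (vnorm (p 0) + fine (TV p)) => t.
have tvp (s : R) : 0 <= s -> vnorm (p s) <= vnorm (p 0) + fine (TV p).
  move=> s0; rewrite -{1}(subrK (p 0) (p s)) addrC.
  apply: (le_trans (vnormD _ _)); rewrite lerD2l.
  have h := vnorm_diff_le_TV p _ _ s0.
  rewrite -lee_fin fineK// ge0_fin_numE//.
  by apply: le_trans h; rewrite lee_fin vnorm_ge0.
by have [t0|/ltW/tvp//] := leP t 0; rewrite (p0 t t0); exact: tvp.
Qed.

Lemma TV_lin p q (a : R) :
  (TV (fun t => p t + a *: q t)%R <= TV p + `|a|%:E * TV q)%E.
Proof.
apply: ge_ereal_sup => _ [n [s [sn ->]]].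
apply: (@le_trans _ _ ((\sum_(i < n) vnorm (p (s i.+1) - p (s i)))%:E +
   `|a|%:E * (\sum_(i < n) vnorm (q (s i.+1) - q (s i)))%:E)%E).
  rewrite -EFinM -EFinD lee_fin mulr_sumr -big_split/=; apply: ler_sum => i _.
  by rewrite -vnormZ opprD addrACA -scalerBr vnormD.
apply: leeD; first by apply: ereal_sup_ubound; exists n, s.
by apply: lee_wpmul2l; rewrite ?lee_fin//; apply: ereal_sup_ubound; exists n, s.
Qed.

Lemma in_X_lin (T : R) p q (a : R) : in_X T p -> in_X T q ->
  in_X T (fun t => p t + a *: q t).
Proof.
move=> [p1 p2 p3 p4] [q1 q2 q3 q4]; split.
- by move=> t; apply: cvgD; [exact: p1|apply: cvgZl_tmp; exact: q1].
- apply: (le_lt_trans (TV_lin _ _ _)); apply: lte_add_pinfty => //.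
  by apply: lte_mul_pinfty => //; rewrite lee_fin.
- by move=> t t0; rewrite (p3 t)// (q3 t).
- by move=> s t sT tT; rewrite (p4 s t)// (q4 s t).
Qed.

Lemma leftcont_coord p (t : R) i : p s @[s --> t^'-] --> p t ->
  p s ord0 i @[s --> t^'-] --> p t ord0 i.
Proof.
move=> pt; have := @coord_continuous R 1 d ord0 i (p t).
exact: cvg_comp.
Qed.

End Paths.

Section AlmostEverywhere.
Context {dO : measure_display} {Omega : measurableType dO} {R : realType}.
Variable P : {measure set Omega -> \bar R}.

Lemma ae_null_set (Q : Omega -> Prop) : {ae P, forall w, Q w} ->
  exists N, [/\ measurable N, P N = 0%E & forall w, ~ N w -> Q w].
Proof.
move=> [N [mN N0 QN]]; exists N; split => // w nN.
by apply: contrapT => nQ; apply: nN; exact: QN.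
Qed.

Lemma ge0_integral_lty_ae (f : Omega -> \bar R) : measurable_fun setT f ->
  (forall w, 0 <= f w)%E -> (\int[P]_w f w < +oo)%E -> {ae P, forall w, (f w < +oo)%E}.
Proof.
move=> mf f0 fi.
have If : P.-integrable setT f.
  apply/integrableP; split => //; apply: le_lt_trans fi.
  by under eq_integral do rewrite gee0_abs//.
apply: filterS (integrable_ae measurableT If) => w /(_ I).
by rewrite ge0_fin_numE.
Qed.

End AlmostEverywhere.

(** * Adapted processes and almost sure properties *)

Section Filtered.
Context {dO : measure_display} {Omega : measurableType dO} {R : realType}.
Context {d : nat} (P : probability Omega R) (F : R -> set (set Omega)) (T : R).

(** A sigma-algebra generates itself, so [Gmeas G] is ordinary measurability on the type generated
    by [G], where sums and products are available. *)
Lemma Gmeas_lin (G : set (set Omega)) (f g : Omega -> R) (a : R) :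
  sigma_algebra setT G -> Gmeas G f -> Gmeas G g ->
  Gmeas G (fun w => f w + a * g w).
Proof.
move=> sG; have measE : (measurable : set (set (g_sigma_algebraType G))) = G.
  exact: sigma_algebra_id.
have toG (u : Omega -> R) : measurable_fun (setT : set (g_sigma_algebraType G)) u <-> Gmeas G u.
  split=> [mu B mB|mu _ B mB]; last by rewrite setTI measE; exact: mu.
  by have := mu measurableT B mB; rewrite setTI measE.
move=> /toG mf /toG mg; apply/toG; apply: measurable_funD => //.
exact: measurable_funM.
Qed.

Lemma Ninf_lin (x y : Omega -> R -> 'rV[R]_d) (a : R) :
  usual_filtration P F -> Ninf P F T x -> Ninf P F T y ->
  Ninf P F T (fun w t => x w t + a *: y w t).
Proof.
move=> [sF _ _ _ _] [x1 x2 [M xM]] [y1 y2 [M' yM]]; split.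
- move=> t t0 i.
  rewrite (_ : (fun w => _) = (fun w => x w t ord0 i + a * y w t ord0 i)).
    by apply: Gmeas_lin; [exact: sF|exact: x1|exact: y1].
  by apply/funext => w; rewrite !mxE.
- by apply: filterS2 x2 y2 => w; exact: in_X_lin.
- exists (M + `|a| * M'); apply: filterS2 xM yM => w xw yw.
  apply: (le_trans (TV_lin _ _ _)); rewrite EFinD EFinM leeD//.
  by rewrite lee_wpmul2l// lee_fin.
Qed.

(** A single value [-oo] of [k w] makes its conjugate identically [+oo], yet along some [y] the
    conjugate has an integrable positive part. *)
Lemma conjugate_ae_gtNy (k : Omega -> 'rV[R]_d -> \bar R) :
  measurable_epi k -> proper_on (L1 P) (Ek P (conjugate k)) ->
  {ae P, forall w, forall x, (-oo < k w x)%E}.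
Proof.
move=> mk [_ [y [[my _] Ey]]].
have mc : measurable_fun setT (fun w => conjugate k w (y w)).
  exact: measurable_conjugate.
have fi : (\int[P]_w ((fun w => conjugate k w (y w))^\+)%E w < +oo)%E.
  rewrite ltNge leye_eq; apply/negP => /eqP /xint_y Y.
  by move: Ey; rewrite /Ek /Ex Y.
have := ge0_integral_lty_ae P _ (measurable_funepos mc) (fun=> funepos_ge0 _ _) fi.
apply: filterS => w cw x; rewrite ltNge leeNy_eq; apply/negP => /eqP kx.
suff cy : conjugate k w (y w) = +oo%E.
  by move: cw; rewrite funeposE cy maxye.
apply/eqP; rewrite -leye_eq; apply: ereal_sup_ubound.
by exists x => //; rewrite kx.
Qed.

(** Replacing the exceptional paths by 0 makes every path left-continuous, hence the process jointly
    measurable. *)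
Lemma measurable_modification (x : Omega -> R -> 'rV[R]_d) (N : set Omega) :
  (forall t, 0 <= t -> F t `<=` measurable) ->
  (forall t, 0 <= t -> Gmeasv (F t) (fun w => x w t)) ->
  measurable N -> (forall w, ~ N w -> in_X T (x w)) ->
  measurable_coords (fun p : Omega * R => if p.1 \in N then 0 else x p.1 p.2).
Proof.
move=> Fm ax mN xX i.
apply: (leftcont_measurable (fun w t => (if w \in N then 0 else x w t) ord0 i)).
- have pos (t : R) : 0 <= t ->
      measurable_fun setT (fun w => (if w \in N then 0 else x w t) ord0 i).
    move=> t0; have mx : measurable_fun setT (fun w => x w t ord0 i).
      by move=> _ B mB; rewrite setTI; apply: (Fm t t0); exact: ax.
    rewrite (_ : (fun w => _) = (fun w => if w \in N then 0 else x w t ord0 i)).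
      apply: measurable_fun_ifT => //.
      by apply: (measurable_fun_bool true); rewrite setTI /= preimage_mem_true.
    by apply/funext => w; case: ifP => _; rewrite ?mxE.
  (* Adaptedness says nothing before time 0; there the paths kept have their value at 0. *)
  move=> t; have [t0|/ltW/pos//] := leP t 0.
  rewrite (_ : (fun w => _) = (fun w => (if w \in N then 0 else x w 0) ord0 i)).
    exact: pos.
  apply/funext => w; case: ifPn => // /negP; rewrite inE => /xX[_ _ x0 _].
  by rewrite x0.
- move=> w t; case: ifPn => [_|/negP]; first exact: cvg_cst.
  by rewrite inE => /xX[xl _ _ _]; exact: leftcont_coord.
Qed.

End Filtered.

(** * The recession function of the integral functional *)

Section ConvexIntegral.
Context {R : realType} {d : nat} (m : {measure set R -> \bar R}) (D : set R).
Hypothesis mD : measurable D.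
Variables (g : R -> 'rV[R]_d -> \bar R) (u x : R -> 'rV[R]_d).
Hypothesis clg : forall t, D t -> epi_closed (g t).
Hypothesis cvx_g : forall t, D t -> convex_ext (g t).
Hypothesis gN : forall t y, D t -> (-oo < g t y)%E.
Hypothesis mg : forall a : R, measurable_fun D (fun t => g t (u t + a *: x t)).
Hypothesis mgu : measurable_fun D (fun t => g t (u t)).
Hypothesis gneg : forall a : R,
  (\int[m]_(t in D) ((fun t => g t (u t + a *: x t)%R)^\-)%E t < +oo)%E.
Hypothesis fin_u : xint m D (fun t => g t (u t)) \is a fin_num.

(** A finite integral at [u] gives finite base values off a null set [N]. On [D] without [N] each
    integrand has monotone slopes whose supremum is its recession function. *)
Lemma xint_convex_slope :
  slope_mono (fun a => xint m D (fun t => g t (u t + a *: x t)))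
    (xint m D (fun t => g t (u t))) /\
  xint m D (fun t => recession (g t) (x t)) =
  slope_sup (fun a => xint m D (fun t => g t (u t + a *: x t)))
    (xint m D (fun t => g t (u t))).
Proof.
have Iu := xint_fin_integrable _ _ mD _ mgu fin_u.
have [N [mN N0 finN]] := ae_null_set _ _ (integrable_ae mD Iu).
have mDN : measurable (D `\` N) by exact: measurableD.
have finDN t : (D `\` N) t -> g t (u t) \is a fin_num by move=> [Dt /finN]; exact.
have E := xint_setD_null m D N _ mN N0.
have mono t : (D `\` N) t -> slope_mono (fun a => g t (u t + a *: x t)) (g t (u t)).
  move=> DNt; have [Dt _] := DNt.
  by apply: convex_slope_mono; [exact: cvx_g|move=> y; exact: gN|exact: finDN].
have mg' (a : R) : 0 < a -> measurable_fun (D `\` N) (fun t => g t (u t + a *: x t)).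
  by move=> _; apply: measurable_funS (mg a) => //; exact: subDsetl.
have mgu' : measurable_fun (D `\` N) (fun t => g t (u t)).
  by apply: measurable_funS mgu => //; exact: subDsetl.
have fin_u' : xint m (D `\` N) (fun t => g t (u t)) \is a fin_num by rewrite -E.
have gN' (a : R) : 0 < a -> (-oo < xint m (D `\` N) (fun t => g t (u t + a *: x t)%R))%E.
  by move=> _; rewrite -E; exact/xint_gtNy/gneg.
have := xint_slope_mono m _ mDN (fun a t => g t (u t + a *: x t)) _ mg' mgu' mono fin_u' gN'.
have := xint_slope_sup m _ mDN (fun a t => g t (u t + a *: x t)) _ mg' mgu' mono fin_u' gN'.
have -> : (fun a => xint m (D `\` N) (fun t => g t (u t + a *: x t))) =
          (fun a => xint m D (fun t => g t (u t + a *: x t))).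
  by apply/funext => a; rewrite -E.
rewrite -!E => <- M; split => //.
rewrite E [RHS]E; apply: eq_xint => t; rewrite inE => DNt; have [Dt _] := DNt.
by apply: recession_slope_sup; [exact: cvx_g|exact: clg|move=> y; exact: gN|exact: finDN].
Qed.

End ConvexIntegral.

Theorem theorem13 (R : realType) (d : nat) (T : R)
  (dO : measure_display) (Omega : measurableType dO)
  (P : probability Omega R) (F : R -> set (set Omega))
  (mu : Omega -> {measure set R -> \bar R})
  (h : Omega -> R -> 'rV[R]_d -> \bar R)
  (k0 kT : Omega -> 'rV[R]_d -> \bar R) :
  0 < T -> (0 < d)%N ->
  usual_filtration P F ->
  random_measure P T mu ->
  optional_measure P F T mu ->
  predictable_convex_normal F T h ->
  (exists (v : Omega -> R -> 'rV[R]_d) (alpha : Omega -> R -> R),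
      [/\ L1eta P T mu v, L1eta_scalar P T mu alpha,
          (forall w t, 0 <= alpha w t) &
          forall w t x, 0 <= t <= T ->
            ((dotv x (v w t) - alpha w t)%:E <= h w t x)%E]) ->
  convex_normal (F 0) k0 ->
  convex_normal (F T) kT ->
  proper_on (Linf P) (Ek P k0) -> proper_on (Linf P) (Ek P kT) ->
  proper_on (L1 P) (Ek P (conjugate k0)) -> proper_on (L1 P) (Ek P (conjugate kT)) ->
  proper_on (Ninf P F T) (Ef P T mu h k0 kT) ->
  forall ubar x : Omega -> R -> 'rV[R]_d,
    Ninf P F T ubar -> Ninf P F T x ->
    (Ef P T mu h k0 kT ubar < +oo)%E ->
    recession_at (Ef P T mu h k0 kT) ubar x =
    Ex P (fun w => (Ig T mu (fun w' t => recession (h w' t)) x w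
                    + recession (k0 w) (x w 0%R)
                    + recession (kT w) (xTplus T (x w)))%E).
Proof.
move=> T0 _ uF [mu0 mufin mmu _ _] _ [hcc hpred] [v [alpha [[mv vfin] [malpha afin] alpha0 hlow]]].
move=> [kk0 mk0] [kkT mkT] _ _ k0c kTc [Efproper _] u x Nu Nx Efu.
have [_ Fm _ _ _] := uF.
have mDT : measurable (I0T T : set R).
  rewrite (_ : I0T T = `[0, T]%classic); first exact: measurable_itv.
  by apply/seteqP; split => t; rewrite /I0T /= in_itv.
have mufinT w : (mu w setT < +oo)%E.
  have : (mu w setT <= mu w (I0T T) + mu w (~` I0T T))%E.
    by rewrite -(setUv (I0T T)); exact: measureU2 mDT (measurableC mDT).
  by rewrite mu0 adde0 => /le_lt_trans; apply.
(* [h] extended by [+oo] outside [0, T], so that the epigraph is empty there *)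
pose hx (p : Omega * R) y := if 0 <= p.2 <= T then h p.1 p.2 y else +oo%E.
have mhx : measurable_epi hx.
  move=> O oO; have := hpred O oO.
  move=> /(predictable_measurable F Fm); congr (measurable _).
  apply/seteqP; split => [p /= [pT [q [Oq hq]]]|p /= [q [Oq]]].
    by exists q; rewrite /hx pT.
  rewrite /hx; case: ifPn => // pT hq; split => //.
  by exists q.
have hxcl p : epi_closed (hx p).
  rewrite /hx /epi_closed; case: (boolP (0 <= p.2 <= T)) => pT; first by have [] := hcc p.1 p.2 pT.
  rewrite (_ : mkset _ = set0); first exact: closed0.
  by apply/seteqP; split => q.
have mk0' : measurable_epi k0 by move=> O oO; apply: (Fm 0) => //; exact: mk0.
have mkT' : measurable_epi kT by move=> O oO; apply: (Fm T); [exact: ltW|exact: mkT].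
have mvnorm : measurable_fun setT (fun p : Omega * R => vnorm (v p.1 p.2)).
  exact: measurable_vnorm.
have [uad uX _] := Nu; have [xad xX _] := Nx.
pose V w := (\int[mu w]_(t in I0T T) (vnorm (v w t))%:E)%E.
pose A w := (\int[mu w]_(t in I0T T) `|alpha w t|%:E)%E.
have Vae : {ae P, forall w, (V w < +oo)%E}.
  apply: ge0_integral_lty_ae => //.
    apply: (measurable_integral_kernel mu _ (fun p => (vnorm (v p.1 p.2))%:E)) => //.
      exact/measurable_EFinP.
    by move=> p; rewrite lee_fin vnorm_ge0.
  by move=> w; apply: integral_ge0 => t _; rewrite lee_fin vnorm_ge0.
have Aae : {ae P, forall w, (A w < +oo)%E}.
  apply: ge0_integral_lty_ae => //.
    apply: (measurable_integral_kernel mu _ (fun p => `|alpha p.1 p.2|%:E)) => //.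
    by apply/measurable_EFinP; exact: measurableT_comp.
  by move=> w; apply: integral_ge0.
have k0ae := conjugate_ae_gtNy P k0 mk0' k0c.
have kTae := conjugate_ae_gtNy P kT mkT' kTc.
(* One null set, independent of [a], serves all points of the ray. *)
have [N0 [mN0 PN0 good]] := ae_null_set _ _
  (filterI uX (filterI xX (filterI Vae (filterI Aae (filterI k0ae kTae))))).
have gu w (nw : ~ N0 w) : in_X T (u w) by have [] := good w nw.
have gx w (nw : ~ N0 w) : in_X T (x w) by have [_ []] := good w nw.
have gV w (nw : ~ N0 w) : (V w < +oo)%E by have [_ [_ []]] := good w nw.
have gA w (nw : ~ N0 w) : (A w < +oo)%E by have [_ [_ [_ []]]] := good w nw.
have gk0 w (nw : ~ N0 w) : forall y, (-oo < k0 w y)%E.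
  by have [_ [_ [_ [_ []]]]] := good w nw.
have gkT w (nw : ~ N0 w) : forall y, (-oo < kT w y)%E.
  by have [_ [_ [_ [_ []]]]] := good w nw.
pose u' w t := if w \in N0 then 0 else u w t.
pose x' w t := if w \in N0 then 0 else x w t.
have mu' : measurable_coords (fun p : Omega * R => u' p.1 p.2).
  exact: measurable_modification Fm uad mN0 gu.
have mx' : measurable_coords (fun p : Omega * R => x' p.1 p.2).
  exact: measurable_modification Fm xad mN0 gx.
pose y' (a : R) (p : Omega * R) := u' p.1 p.2 + a *: x' p.1 p.2.
have my' a : measurable_coords (y' a).
  move=> i; rewrite (_ : (fun p => _) =
    (fun p : Omega * R => u' p.1 p.2 ord0 i + a * x' p.1 p.2 ord0 i)).
    apply: measurable_funD; first exact: mu'.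
    by apply: measurable_funM => //; exact: mx'.
  by apply/funext => p; rewrite /y' !mxE.
have y'E a w t : ~ N0 w -> y' a (w, t) = u w t + a *: x w t.
  by move=> nw; rewrite /y' /u' /x' /= memNset.
have mhy a : measurable_fun setT (fun p => hx p (y' a p)).
  exact: measurable_normal_comp.
pose ux a w t := u w t + a *: x w t.
have hE a w t : ~ N0 w -> I0T T t -> hx (w, t) (y' a (w, t)) = h w t (ux a w t).
  by move=> nw tT; rewrite /hx /= ifT// y'E.
have ux0 : ux 0 = u by apply/funext => w; apply/funext => t; rewrite /ux scale0r addr0.
have mht a w : ~ N0 w -> measurable_fun (I0T T) (fun t => h w t (ux a w t)).
  move=> nw; apply: (eq_measurable_fun (fun t => hx (w, t) (y' a (w, t)))).
    by move=> t; rewrite inE => tT; exact: hE.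
  apply: measurable_funTS; apply: (measurableT_comp (mhy a)).
  exact: measurable_fun_pair.
(* With [C] bounding the path, the minorant of [h] bounds the negative part by
   [C * vnorm v + |alpha|]. *)
have hneg a w : ~ N0 w ->
    (\int[mu w]_(t in I0T T) ((fun t => h w t (ux a w t))^\-)%E t < +oo)%E.
  move=> nw.
  have [Cu uC] := in_X_bounded _ _ (gu w nw).
  have [Cx xC] := in_X_bounded _ _ (gx w nw).
  have msec (f : Omega * R -> R) : measurable_fun setT f ->
      measurable_fun (I0T T) (fun t => f (w, t)).
    move=> mf; apply: measurable_funTS; apply: (measurableT_comp mf).
    exact: measurable_fun_pair.
  pose C := Cu + `|a| * Cx.
  have uxC t : vnorm (ux a w t) <= C.
    apply: (le_trans (vnormD _ _)); apply: lerD; first exact: uC.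
    by rewrite vnormZ ler_wpM2l.
  have C0 : 0 <= C := le_trans (vnorm_ge0 _) (uxC 0).
  apply: (@le_lt_trans _ _ (C%:E * V w + A w)%E); last first.
    apply: lte_add_pinfty; last exact: gA.
    by apply: lte_mul_pinfty; [rewrite lee_fin| |exact: gV].
  have mvw : measurable_fun (I0T T) (fun t => (vnorm (v w t))%:E).
    by apply/measurable_EFinP; exact: (msec (fun p => vnorm (v p.1 p.2))).
  have maw : measurable_fun (I0T T) (fun t => `|alpha w t|%:E).
    apply/measurable_EFinP; apply: (msec (fun p => `|alpha p.1 p.2|)).
    exact: measurableT_comp.
  rewrite /V -ge0_integralZl//; last by move=> t _; rewrite lee_fin vnorm_ge0.
  rewrite /A -ge0_integralD//; first last.
  - exact: measurable_funeM.
  - by move=> t _; rewrite -EFinM lee_fin mulr_ge0// vnorm_ge0.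
  apply: ge0_le_integral => //.
  - by apply: measurable_funeneg; exact: mht.
  - by apply: emeasurable_funD => //; exact: measurable_funeM.
  move=> t tT; rewrite funenegE ge_max; apply/andP; split; last first.
    by rewrite -EFinM -EFinD lee_fin addr_ge0// mulr_ge0// vnorm_ge0.
  rewrite leeNl; apply: le_trans (hlow w t _ tT).
  rewrite -EFinM -EFinD -EFinN lee_fin.
  have := dotv_le (ux a w t) (v w t).
  rewrite ler_norml => /andP[d1 _].
  have := ler_wpM2r (vnorm_ge0 (v w t)) (uxC t).
  have := ler_norm (alpha w t).
  lra.
pose phi a w := (Ig T mu h (ux a) w + k0 w (ux a w 0%R) + kT w (xTplus T (ux a w)))%E.
have EfE a : Ef P T mu h k0 kT (ux a) = xint P setT (phi a) by [].
have mphi a : measurable_fun (~` N0) (phi a).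
  have mC : measurable (~` N0) by exact: measurableC.
  have mIg : measurable_fun (~` N0) (Ig T mu h (ux a)).
    (* Kernel integration applies to nonnegative integrands; off [N0] the negative part has finite
       integral, so [Ig] is the difference of the two integrals. *)
    pose pint w := (\int[mu w]_(t in I0T T) ((fun p => hx p (y' a p))^\+ (w, t)))%E.
    pose nint w := (\int[mu w]_(t in I0T T) ((fun p => hx p (y' a p))^\- (w, t)))%E.
    apply: (eq_measurable_fun (fun w => pint w - nint w)%E).
      move=> w; rewrite inE => nw; rewrite /Ig xint_fneg; last exact: hneg.
      by congr (_ - _)%E; apply: eq_integral => t; rewrite inE => tT;
        rewrite ?funeposE ?funenegE hE.
    apply: measurable_funTS; apply: emeasurable_funB.
      apply: (measurable_integral_kernel mu _ ((fun p => hx p (y' a p))^\+)%E) => //.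
      exact: measurable_funepos.
    apply: (measurable_integral_kernel mu _ ((fun p => hx p (y' a p))^\-)%E) => //.
    exact: measurable_funeneg.
  have mk (k : Omega -> 'rV[R]_d -> \bar R) (s : R) : measurable_epi k ->
      (forall w, epi_closed (k w)) ->
      measurable_fun (~` N0) (fun w => k w (ux a w s)).
    move=> kepi kcl; apply: (eq_measurable_fun (fun w => k w (y' a (w, s)))).
      by move=> w; rewrite inE => nw; rewrite y'E.
    apply: measurable_funTS; apply: measurable_normal_comp => // i.
    by apply: (measurableT_comp (my' a i)); exact: measurable_fun_pair.
  apply: emeasurable_funD; first apply: emeasurable_funD => //.
  - by apply: mk => // w; have [] := kk0 w.
  - by apply: mk => // w; have [] := kkT w.
(* The initial value of an element of [Ninf] need not be essentially bounded, so
   no integrable minorant of [phi a] is available: properness replaces it. *)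
have NIux a : Ninf P F T (ux a) by exact: Ninf_lin.
have PN0E (f : Omega -> \bar R) : xint P setT f = xint P (~` N0) f.
  by rewrite (xint_setD_null P setT N0)// setTD.
have mC0 : measurable (~` N0) by exact: measurableC.
have fin0 : xint P (~` N0) (phi 0) \is a fin_num.
  rewrite -PN0E -EfE fin_numE -lteNye -ltey ux0 Efu andbT.
  exact: Efproper.
have I0 := xint_fin_integrable _ _ mC0 _ (mphi 0) fin0.
(* Off [N1] the sum [phi 0 w] is finite, hence so is each of its three terms; this supplies the
   finite base values for the slope lemmas. *)
have [N1 [mN1 PN1 good1]] := ae_null_set _ _ (integrable_ae mC0 I0).
pose D := ~` N0 `\` N1.
have mD : measurable D by exact: measurableD.
have PDE (f : Omega -> \bar R) : xint P setT f = xint P D f.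
  by rewrite PN0E (xint_setD_null P _ N1).
have pointwise w : D w -> slope_mono (phi^~ w) (phi 0 w) /\
    (Ig T mu (fun w' t => recession (h w' t)) x w + recession (k0 w) (x w 0%R)
      + recession (kT w) (xTplus T (x w)))%E = slope_sup (phi^~ w) (phi 0 w).
  move=> [nw nw1]; have := good1 w nw1 nw.
  rewrite /phi !fin_numD ux0 => /andP[/andP[finI fink0] finkT].
  have [m1 r1] : slope_mono (fun a => Ig T mu h (ux a) w) (Ig T mu h u w) /\
      Ig T mu (fun w' t => recession (h w' t)) x w =
      slope_sup (fun a => Ig T mu h (ux a) w) (Ig T mu h u w) :=
    xint_convex_slope (mu w) _ mDT (h w) (u w) (x w)
    (fun t tT => proj1 (hcc w t tT)) (fun t tT => proj2 (hcc w t tT))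
    (fun t y tT => lt_le_trans (ltNyr _) (hlow w t y tT))
    (fun a => mht a w nw)
    ltac:(by have := mht 0 w nw; rewrite ux0) (fun a => hneg a w nw) finI.
  have [cl0 cv0] := kk0 w; have [clT cvT] := kkT w.
  have m2 := convex_slope_mono _ _ (x w 0) cv0 (gk0 w nw) fink0.
  have m3 := convex_slope_mono _ _ (xTplus T (x w)) cvT (gkT w nw) finkT.
  rewrite r1 (recession_slope_sup _ _ (x w 0) cv0 cl0 (gk0 w nw) fink0).
  rewrite (recession_slope_sup _ _ (xTplus T (x w)) cvT clT (gkT w nw) finkT).
  split; first exact: slope_monoD (slope_monoD _ _ _ _ m1 m2) m3.
  by rewrite -!slope_supD//; exact: slope_monoD.
rewrite /Ex PDE.
rewrite (eq_xint _ _ _ (fun w => slope_sup (phi^~ w) (phi 0 w))); last first.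
  by move=> w; rewrite inE => /pointwise[].
rewrite xint_slope_sup//.
- rewrite /recession_at /slope_sup -PDE -EfE ux0; congr ereal_sup.
  by apply/seteqP; split => z [a [a0 ->]]; exists a; split => //;
    rewrite /slope -PDE.
- by move=> a _; apply: measurable_funS (mphi a) => //; exact: subDsetl.
- by apply: measurable_funS (mphi 0) => //; exact: subDsetl.
- by move=> w /pointwise[].
- by rewrite -PDE PN0E.
- by move=> a _; rewrite -PDE -EfE; exact: Efproper.
Qed.
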